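(* Fix a singular matrix $M_1'\in\mathbb{R}^{2\times2}$ with eigenvalues $0$ and $\lambda_2\in\mathbb{R}\setminus\{0\}$ and a number $\lambda_3\in\mathbb{C}\setminus\{0\}$, and let $\beta$ be the angle parameter of $M_1'$. For $0\le c<1$, the parameter set $L_\beta(c)\subset(0,1)$ (the set of $\alpha$ for which $\tilde\rho=c$ and the infimum defining $\tilde\rho$ is not reached by a finite $l$; see context) has zero Hausdorff dimension.
   Context: $\mathbb{N}$ includes $0$. For a finite set $\mathcal{M}=\{M_1,\dots,M_m\}\subseteq\mathbb{R}^{n\times n}$, consider $x(t+1)=M_{\sigma(t)}x(t)$, $x(0)=x_0$, with switching law $\sigma(\cdot)\in\{1,\dots,m\}$ (allowed to depend on $x_0$). The stabilizability radius is $$\tilde\rho(\mathcal{M})=\sup_{x_0\in\mathbb{R}^n}\inf\{\lambda\ge 0 \mid \exists\,\sigma(\cdot),\ c>0 \text{ such that } \|x(t)\|\le c\lambda^t\|x_0\|\ \ \forall t\ge 0\}.$$ Let $v_1,v_2$ be unit eigenvectors of $M_1'$ for the eigenvalues $0$ and $\lambda_2$, and $\beta\pi=\arccos|\langle v_1,v_2\rangle|$, with the orientation convention that the line $\mathbb{R}v_2$ is obtained from $\mathbb{R}v_1$ by counterclockwise rotation through the angle $\beta\pi$. For $\alpha\in(0,1)$ let $$J=|\lambda_3|\begin{pmatrix}\cos\alpha\pi&\sin\alpha\pi\\-\sin\alpha\pi&\cos\alpha\pi\end{pmatrix}$$ and $\tilde\rho=\tilde\rho(\{M_1',J\})$. It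 is given by $$\tilde\rho=|\lambda_3|\min\left\{1,\ \inf_{l\in\mathbb{N}}\left|\frac{\lambda_2}{\lambda_3}\frac{\sin((l\alpha-\beta)\pi)}{\sin\beta\pi}\right|^{1/(l+1)}\right\}.$$ With $M_1'$ and $\lambda_3$ fixed, $L_\beta(c)$ denotes the set of irrational $\alpha\in(0,1)$ such that $\tilde\rho=c$ and the infimum over $l\in\mathbb{N}$ in this formula is not attained by any finite $l$ (it is approached only as $l$ tends to infinity along a sequence). *)

(* Defs.v *)
From HB Require Import structures.
From mathcomp Require Import all_boot all_order all_algebra.
From mathcomp Require Import complex.
From mathcomp Require Import all_classical all_reals all_analysis.

Set Implicit Arguments.
Unset Strict Implicit.
Unset Printing Implicit Defensive.

Import Order.TTheory GRing.Theory Num.Theory.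
Import numFieldNormedType.Exports.

Local Open Scope classical_set_scope.
Local Open Scope ring_scope.

Section EuclideanSpace.
Variables (R : realType) (n : nat).
Implicit Types u v : 'cV[R]_n.

Definition dot u v : R := \sum_(i < n) u i 0 * v i 0.

(* The norm [`|v|] of MathComp-Analysis on matrices is the sup norm, hence
   this separate Euclidean norm. *)
Definition enorm v : R := Num.sqrt (dot v v).

Definition line v : set 'cV[R]_n := [set k *: v | k in [set: R]].

End EuclideanSpace.

Section StabilizabilityRadius.
Variables (R : realType) (n m : nat) (Ms : m.-tuple 'M[R]_n).

Fixpoint trajectory (sigma : nat -> 'I_m) (x0 : 'cV[R]_n) (t : nat)
    : 'cV[R]_n :=
  if t is t'.+1 then tnth Ms (sigma t') *m trajectory sigma x0 t' else x0.

Definition stabilizing_rates (x0 : 'cV[R]_n) : set R :=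
  [set lambda | 0 <= lambda /\
    exists (sigma : nat -> 'I_m) (c : R), 0 < c /\
      forall t, enorm (trajectory sigma x0 t) <= c * lambda ^+ t * enorm x0].

Definition stabilizability_radius : \bar R :=
  ereal_sup [set ereal_inf [set lambda%:E | lambda in stabilizing_rates x0]
            | x0 in [set: 'cV[R]_n]].

End StabilizabilityRadius.

Section HausdorffDimension.
Variable R : realType.
Implicit Types E U : set R.

Definition diam U : \bar R :=
  ereal_sup [set z | exists x y, [/\ U x, U y & z = `|x - y|%:E]].

(* Conventions: |set0|^s = 0 for all s, and |U|^0 = 1 for nonempty U, so that
   the measure for s = 0 is the counting measure. *)
Definition diam_pow (s : R) U : \bar R :=
  if U == set0 then 0%E else poweR (diam U) s.

Definition delta_cover (delta : R) E (U : nat -> set R) : Prop :=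
  E `<=` \bigcup_i U i /\ forall i, (diam (U i) <= delta%:E)%E.

Definition hausdorff_content (s delta : R) E : \bar R :=
  ereal_inf [set (\sum_(0 <= i <oo) diam_pow s (U i))%E
            | U in [set U | delta_cover delta E U]].

Definition hausdorff_measure (s : R) E : \bar R :=
  ereal_sup [set hausdorff_content s delta E
            | delta in [set delta : R | 0 < delta]].

Definition hausdorff_dim E : \bar R :=
  ereal_inf [set s%:E
            | s in [set s : R | 0 <= s /\ hausdorff_measure s E = 0%E]].

End HausdorffDimension.

Section PlanarPair.
Variable R : realType.

Definition mx2 (a b c d : R) : 'M[R]_2 :=
  \matrix_(i < 2, j < 2)
    if i == 0 then (if j == 0 then a else b) else (if j == 0 then c else d).

Definition rot_ccw (theta : R) : 'M[R]_2 :=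
  mx2 (cos theta) (- sin theta) (sin theta) (cos theta).

Definition is_angle_parameter (M : 'M[R]_2) (lambda2 beta : R) : Prop :=
  exists v1 v2 : 'cV[R]_2,
    [/\ enorm v1 = 1 /\ M *m v1 = 0,
        enorm v2 = 1 /\ M *m v2 = lambda2 *: v2,
        beta * pi = acos `|dot v1 v2| &
        line v2 = [set rot_ccw (beta * pi) *m w | w in line v1]].

Definition Jmx (lambda3 : R[i]) (alpha : R) : 'M[R]_2 :=
  Normc.normc lambda3 *:
    mx2 (cos (alpha * pi)) (sin (alpha * pi))
        (- sin (alpha * pi)) (cos (alpha * pi)).

Definition radius_term (lambda2 : R) (lambda3 : R[i]) (alpha beta : R)
    (l : nat) : R :=
  Normc.normc (real_complex R lambda2 / lambda3 *
         real_complex R (sin ((l%:R * alpha - beta) * pi) / sin (beta * pi)))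
  `^ (l.+1%:R^-1).

Definition Lset (M : 'M[R]_2) (lambda2 : R) (lambda3 : R[i]) (beta c : R)
    : set R :=
  [set alpha | [/\ 0 < alpha < 1, irrational alpha,
    stabilizability_radius [tuple M; Jmx lambda3 alpha] = c%:E &
    forall l, radius_term lambda2 lambda3 alpha beta l
              <> inf (range (radius_term lambda2 lambda3 alpha beta))]].

End PlanarPair.

(* Main.v *)
(* Up to a constant K >= 0, the l-th term of the infimum is
   (K |sin((l alpha - beta) pi)|)^(1/(l+1)). For irrational alpha the points
   l alpha - beta (l in N) are dense modulo 1, so some term is less than 1 and
   the infimum is less than 1. If it is not attained, infinitely many terms lie
   below some g < 1, so alpha is within g^(l+1)/K of a point (beta + j)/l for
   infinitely many l. For each l only O(l) values of j matter, and g^l decays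
   faster than any power of l, so by the Borel-Cantelli covering argument the
   limsup set of these intervals is null for the s-dimensional Hausdorff measure
   for every s > 0. *)

Require Import Defs.
From HB Require Import structures.
From mathcomp Require Import all_boot all_order all_algebra.
From mathcomp Require Import complex.
From mathcomp Require Import all_classical all_reals all_analysis.
From mathcomp Require Import lra zify ring.

Import Order.TTheory GRing.Theory Num.Theory.
Import numFieldNormedType.Exports.

Local Open Scope classical_set_scope.
Local Open Scope ring_scope.

(** * Hausdorff measure and dimension of limsup sets *)

Lemma diam_ge0 {R : realType} (U : set R) : U !=set0 -> (0 <= diam U)%E.
Proof.
move=> [x Ux]; apply: ereal_sup_ubound; exists x, x.
by rewrite subrr normr0.
Qed.

Lemma diam_pow_ge0 {R : realType} (s : R) (U : set R) : (0 <= diam_pow s U)%E.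
Proof. by rewrite /diam_pow; case: ifP => // _; exact: poweR_ge0. Qed.

Lemma diam_pow_le {R : realType} (s d : R) (U : set R) :
  0 <= s -> (diam U <= d%:E)%E -> (diam_pow s U <= (d `^ s)%:E)%E.
Proof.
move=> s_ge0 Ud; rewrite /diam_pow; case: ifPn => [_|U0].
  by rewrite lee_fin powR_ge0.
have dU_ge0 : (0 <= diam U)%E by apply/diam_ge0/set0P.
rewrite -poweR_EFin; apply: gt0_ler_poweR => //.
- by rewrite in_itv /= dU_ge0 leey.
- by rewrite in_itv /= (le_trans dU_ge0) //= leey.
Qed.

Lemma diam_segment {R : realType} (x r : R) :
  (diam [set a : R | (`|a - x| <= r)%R] <= (2 * r)%:E)%E.
Proof.
apply: ge_ereal_sup => _ [a [b [/= ax bx ->]]]; rewrite lee_fin.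
rewrite (_ : a - b = (a - x) - (b - x)); last by ring.
by rewrite (le_trans (ler_normB _ _)) // mulr_natl mulr2n lerD.
Qed.

Lemma sum_inv_sqr_le {R : realType} (N n : nat) :
  \sum_(0 <= i < n) ((N + i).+2%:R ^+ 2)^-1 <= N.+1%:R^-1 :> R.
Proof.
have inv_gt0 (k : nat) : 0 < k.+1%:R^-1 :> R by rewrite invr_gt0 ltr0n.
(* 1 / (t + 1)^2 <= 1 / t - 1 / (t + 1) telescopes. *)
suff: \sum_(0 <= i < n) ((N + i).+2%:R ^+ 2)^-1
    <= N.+1%:R^-1 - (N + n).+1%:R^-1 :> R.
  by move=> /le_trans; apply; rewrite gerBl ltW.
elim: n => [|n IHn]; first by rewrite big_geq // addn0 subrr.
rewrite big_nat_recr //= addnS.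
set t : R := (N + n).+1%:R in IHn *.
have t_gt0 : 0 < t by rewrite ltr0n.
have -> : (N + n).+2%:R = t + 1 by rewrite -natr1.
suff h : ((t + 1) ^+ 2)^-1 <= t^-1 - (t + 1)^-1.
  by have := lerD IHn h; rewrite addrA subrK.
rewrite -subr_ge0 (_ : _ - _ = (t * (t + 1) ^+ 2)^-1).
  by rewrite invr_ge0 mulr_ge0 ?sqr_ge0 // ltW.
by field; apply/andP; split; rewrite lt0r_neq0 //; lra.
Qed.

(** For every [N] the balls about [x i], [i > N], of radius [(i + 1)^-p] cover [E]. Once
    [p * s >= 2], their diameters to the power [s] sum to at most a constant times a tail of the
    series of inverse squares. *)
Lemma hausdorff_measure_fast_limsup {R : realType} (E : set R) (x : nat -> R)
    (s : R) :
  0 < s ->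
  (forall a, E a -> forall p N : nat,
    exists2 i, (N <= i)%N & `|a - x i| <= (i.+1%:R ^+ p)^-1) ->
  hausdorff_measure s E = 0%E.
Proof.
move=> s_gt0 Ex; apply/eqP; rewrite eq_le; apply/andP; split; last first.
  apply: (@le_trans _ _ (hausdorff_content s 1 E)); last first.
    by apply: ereal_sup_ubound; exists 1 => //=.
  apply: le_ereal_inf_tmp => _ [U _ <-].
  by apply: nneseries_ge0 => i _ _; exact: diam_pow_ge0.
apply: ge_ereal_sup => _ [d /= d_gt0 <-].
apply/lee_addgt0Pr => e e_gt0; rewrite add0e.
pose p := (Num.truncn (2 / s)).+1.
have ps_ge2 : 2 <= p%:R * s.
  by rewrite -ler_pdivrMr // ltW // truncnS_gt.
pose C : R := 2 `^ s.
have C_ge0 : 0 <= C by exact: powR_ge0.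
(* The summand [2 / d] brings the diameters below [d], and [C / e] brings the total sum below
   [e]. *)
pose N := Num.truncn (2 / d + C / e).
have Nlarge : 2 / d + C / e <= N.+1%:R by rewrite ltW // truncnS_gt.
have N_gt0 : 0 < N.+1%:R :> R by rewrite ltr0n.
(* The [i]-th centre has index [(N + i).+1], so the radius allowed there involves [(N + i).+2]. *)
pose r i : R := ((N + i).+2%:R ^+ p)^-1.
have r_gt0 i : 0 < r i by rewrite invr_gt0 exprn_gt0 // ltr0n.
pose U i := [set a : R | `|a - x (N + i).+1| <= r i].
apply: (@le_trans _ _ (\sum_(0 <= i <oo) diam_pow s (U i))%E).
  apply: ereal_inf_lbound; exists U => //; split.
    move=> a /Ex /(_ p N.+1) [i Ni axi]; exists (i - N.+1)%N => //=.
    by rewrite /U /r /= (_ : (N + (i - N.+1)).+1 = i)%N //; lia.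
  move=> i; apply: (le_trans (diam_segment _ _)); rewrite lee_fin.
  have rN : r i <= N.+1%:R^-1.
    rewrite lef_pV2 ?posrE ?exprn_gt0 ?ltr0n // (@le_trans _ _ (N + i).+2%:R)//.
      by rewrite ler_nat; lia.
    by rewrite ler_eXnr // ler1n.
  rewrite (le_trans (ler_wpM2l _ rN)) // ler_pdivrMr //.
  rewrite mulrC -ler_pdivrMr // (le_trans _ Nlarge) // lerDl divr_ge0 // ltW //.
apply: lime_le.
  by apply: is_cvg_ereal_nneg_natsum => i _; exact: diam_pow_ge0.
near=> n.
apply: (@le_trans _ _ (\sum_(0 <= i < n) (C * ((N + i).+2%:R ^+ 2)^-1)%:E)%E).
  apply: lee_sum => i _.
  apply: (le_trans (diam_pow_le _ _ _ (ltW s_gt0) (diam_segment _ _))).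
  rewrite lee_fin powRM ?ler_wpM2l // ?(ltW (r_gt0 i)) //.
  have b_ge0 : 0 <= (N + i).+2%:R :> R by rewrite ler0n.
  rewrite /r -powR_mulrn // -powRN -powRrM mulNr powRN.
  rewrite lef_pV2 ?posrE ?powR_gt0 ?exprn_gt0 ?ltr0n // -powR_mulrn //.
  by rewrite ler_powR // ler1n.
rewrite sumEFin lee_fin -mulr_sumr.
rewrite (le_trans (ler_wpM2l C_ge0 (sum_inv_sqr_le N n))) //.
rewrite ler_pdivrMr // mulrC -ler_pdivrMr // (le_trans _ Nlarge) //.
by rewrite lerDr divr_ge0 // ltW.
Unshelve. all: by end_near.
Qed.

Lemma hausdorff_dim_fast_limsup {R : realType} (E : set R) (x : nat -> R) :
  (forall a, E a -> forall p N : nat,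
    exists2 i, (N <= i)%N & `|a - x i| <= (i.+1%:R ^+ p)^-1) ->
  hausdorff_dim E = 0%E.
Proof.
move=> Ex; apply/eqP; rewrite eq_le; apply/andP; split.
  apply/lee_addgt0Pr => s s_gt0; rewrite add0e.
  apply: ereal_inf_lbound; exists s => //; split; first exact: ltW.
  exact: (hausdorff_measure_fast_limsup E x).
by apply: le_ereal_inf_tmp => _ [s [s_ge0 _] <-]; rewrite lee_fin.
Qed.

(** * The sine and the distance to the nearest integer *)

Lemma sin_ge_half {R : realType} (x : R) :
  0 <= x <= pi / 2 -> x / 2 <= sin x.
Proof.
move=> /andP[x_ge0 x_le].
have pi_gt0 := pi_gt0 R.
(* The mean value theorem gives [sin (x / 2) = cos c * (x / 2)] with [c <= x / 2], and the cosine
   decreases there. *)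
have h : x / 2 * cos (x / 2) <= sin (x / 2).
  have [||c] := @MVT_segment R sin cos 0 (x / 2).
  - by rewrite divr_ge0.
  - by apply: continuous_subspaceT => y; exact: continuous_sin.
  rewrite in_itv /= => /andP[c_ge0 c_le].
  rewrite sin0 !subr0 => ->.
  rewrite mulrC ler_wpM2r ?divr_ge0 //.
  have [->//|cx] := eqVneq c (x / 2).
  apply/ltW; rewrite ltr_cos ?in_itv /=; first by rewrite lt_neqAle cx.
    by apply/andP; split; lra.
  by apply/andP; split; lra.
have cos_ge0 y : 0 <= y <= pi / 2 -> 0 <= cos y :> R.
  by move=> /andP[y0 y1]; apply: cos_ge0_pihalf; apply/andP; split; lra.
have cx : 0 <= cos x by apply: cos_ge0; rewrite x_ge0.
have ch : 0 <= cos (x / 2) by apply: cos_ge0; apply/andP; split; lra.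
(* sin x = 2 sin(x/2) cos(x/2) >= x cos(x/2)^2 = x (1 + cos x) / 2 *)
have -> : sin x = (cos (x / 2) * sin (x / 2)) *+ 2.
  by rewrite -sin_mulr2n -[x / 2 *+ 2]mulr_natr divfK.
have : cos x = cos (x / 2) ^+ 2 *+ 2 - 1.
  by rewrite -cos_mulr2n -[x / 2 *+ 2]mulr_natr divfK.
move: (ler_wpM2l ch h); set C := cos (x / 2); set S := sin (x / 2).
move=> h' cxE; rewrite -mulr_natr.
have : x * (C ^+ 2 * 2 - 1) >= 0 by rewrite mulr_ge0 // mulr_natr -cxE.
nra.
Qed.

Lemma norm_sinDint {R : realType} (x : R) (m : int) :
  `|sin (x + m%:~R * pi)| = `|sin x|.
Proof.
have sinDnat (y : R) (n : nat) : `|sin (y + n%:R * pi)| = `|sin y|.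
  rewrite mulr_natl (alternatingn (@sinDpi R)).
  by rewrite normrM normrX normrN1 expr1n mul1r.
case: m => n; first exact: sinDnat.
rewrite NegzE -(sinDnat (x + _) n.+1) mulrNz mulNr.
by rewrite -[(n.+1)%:~R]/(n.+1%:R) subrK.
Qed.

(** Subtracting the nearest integer [j] leaves [|sin|] unchanged and reduces to [|t| <= 1 / 2],
    where [sin (|t| pi) >= |t| pi / 2 >= |t|] because [pi >= 2]. *)
Lemma dist_int_le_norm_sin {R : realType} (y : R) :
  exists j : int, `|y - j%:~R| <= 1 / 2 /\ `|y - j%:~R| <= `|sin (y * pi)|.
Proof.
have pi_ge2 := pi_ge2 R.
exists (Num.floor (y + 1 / 2)).
set j := Num.floor _; have /andP[jl ju] := floor_itv (y + 1 / 2).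
rewrite -/j intrD in jl ju.
have y_le : `|y - j%:~R| <= 1 / 2 by rewrite ler_norml; apply/andP; split; lra.
split=> //.
have -> : y * pi = (y - j%:~R) * pi + j%:~R * pi by rewrite -mulrDl subrK.
rewrite norm_sinDint; move: (y - j%:~R) y_le => t t_le.
have -> : `|sin (t * pi)| = `|sin (`|t| * pi)|.
  by case: (ger0P t) => // _; rewrite mulNr sinN normrN.
rewrite (le_trans _ (ler_norm _)) // (le_trans _ (sin_ge_half _ _)) //.
  have := normr_ge0 t; nra.
by have := normr_ge0 t => t_ge0; apply/andP; split; nra.
Qed.

(** * Diophantine approximation *)

Lemma irrational_dist_gt0 {R : realType} (a : R) (q : nat) (m : int) :
  irrational a -> (0 < q)%N -> 0 < `|q%:R * a - m%:~R|.
Proof.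
move=> a_irr q_gt0; rewrite normr_gt0 subr_eq0; apply/eqP => qam.
apply: a_irr; apply/rationalP; exists m, q.
by rewrite -qam mulrC mulKf // pnatr_eq0 -lt0n.
Qed.

(** Pigeonhole: among the [n + 2] fractional parts of [i * a], two share one of [n + 1] bins of
    length [1 / (n + 1) < d]. *)
Lemma dirichlet_approx {R : realType} (a d : R) :
  0 < d -> exists (q : nat) (m : int), (0 < q)%N /\ `|q%:R * a - m%:~R| < d.
Proof.
move=> d_gt0; pose n := Num.truncn d^-1.
have n_gt : d^-1 < n.+1%:R by exact: truncnS_gt.
pose frac (i : nat) : R := i%:R * a - (Num.floor (i%:R * a))%:~R.
have frac_itv i : 0 <= frac i < 1.
  have := floor_itv (i%:R * a); rewrite /frac intrD.
  by move=> /andP[? ?]; apply/andP; split; lra.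
have bin_itv i : (Num.truncn (n.+1%:R * frac i))%:R <= n.+1%:R * frac i
    < (Num.truncn (n.+1%:R * frac i)).+1%:R.
  by apply: truncn_itv; rewrite mulr_ge0 //; case/andP: (frac_itv i).
have bin_lt i : (Num.truncn (n.+1%:R * frac i) < n.+1)%N.
  have /andP[bl _] := bin_itv i; have /andP[_ fu] := frac_itv i.
  by rewrite -(ltr_nat R) (le_lt_trans bl) // gtr_pMr ?ltr0n.
pose bin (i : 'I_n.+2) : 'I_n.+1 := Ordinal (bin_lt i).
have [i [j [ij binij]]] : exists i j : 'I_n.+2, (i < j)%N /\ bin i = bin j.
  have /injectivePn[i [j ij binij]] : ~~ injectiveb bin.
    by apply/negP => /injectiveP /leq_card; rewrite !card_ord ltnn.
  have [lt_ij|lt_ji|/val_inj eq_ij] := ltngtP i j.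
  - by exists i, j.
  - by exists j, i.
  - by rewrite eq_ij eqxx in ij.
exists (j - i)%N, (Num.floor (j%:R * a) - Num.floor (i%:R * a)).
split; first by rewrite subn_gt0.
rewrite natrB ?(ltnW ij) // intrB.
rewrite (_ : _ - _ = frac j - frac i); last by rewrite /frac; ring.
have n_gt0 : 0 < n.+1%:R :> R by rewrite ltr0n.
have small : `|n.+1%:R * (frac j - frac i)| < 1.
  have /andP[jl ju] := bin_itv j; have /andP[il iu] := bin_itv i.
  have e : Num.truncn (n.+1%:R * frac i) = Num.truncn (n.+1%:R * frac j).
    by have := congr1 val binij.
  rewrite e in il iu; rewrite -[ltRHS]natr1 in iu; rewrite -[ltRHS]natr1 in ju.
  rewrite mulrBr ltr_norml; apply/andP; split; lra.
rewrite normrM gtr0_norm // in small.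
rewrite -(ltr_pM2l n_gt0) (lt_le_trans small) //.
by rewrite -ler_pdivrMr // mul1r ltW.
Qed.

(** With [e = q * a - m] nonzero and smaller than [d], the multiples of [e] form a grid of mesh
    below [d], so one of them comes within [d] of [b] modulo 1. *)
Lemma kronecker_approx {R : realType} (a b d : R) : irrational a -> 0 < d ->
  exists (l : nat) (m : int), `|l%:R * a - b - m%:~R| < d.
Proof.
move=> a_irr d_gt0; have [q [m [q_gt0]]] := dirichlet_approx a d d_gt0.
have := irrational_dist_gt0 a q m a_irr q_gt0.
set e : R := _ - _; rewrite normr_gt0 => e_neq0 e_lt.
(* As [l] must be a natural number, [b] is first shifted by an integer so that [b - s] lies on the
   same side of 0 as [e]. *)
have [s s_ge0] : exists s : int, 0 <= (b - s%:~R) / e.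
  have /andP[bl bu] := floor_itv b; rewrite intrD in bu.
  have [e_gt0|e_le0] := ltP 0 e.
    by exists (Num.floor b); apply: divr_ge0; [rewrite subr_ge0|exact: ltW].
  exists (Num.floor b + 1); rewrite -mulrNN -invrN.
  by apply: divr_ge0; rewrite oppr_ge0 // intrD subr_le0 ltW.
have /andP[kl ku] := truncn_itv s_ge0; set k := Num.truncn _ in kl ku.
exists (k * q)%N, (m * k%:Z - s); rewrite intrB intrM natrM.
rewrite (_ : _ - _ = (k%:R - (b - s%:~R) / e) * e); last first.
  by rewrite mulrBl divfK // /e; ring.
rewrite -natr1 in ku; rewrite normrM (le_lt_trans _ e_lt) // ler_piMl //.
by rewrite ler_norml; apply/andP; split; lra.
Qed.

(** * Infima that are not attained, and growth estimates *)

Lemma frequently_lt_inf_not_attained {R : realType} (u : nat -> R) :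
  has_lbound (range u) -> (forall l, u l <> inf (range u)) ->
  forall (N : nat) (g : R), inf (range u) < g ->
  exists2 l, (N <= l)%N & u l < g.
Proof.
move=> u_lb u_inf; elim=> [|N IHN] g g_gt.
  have u0 : range u !=set0 by exists (u 0%N), 0%N.
  by have [_ [l _ <-] ul] := inf_lt u0 g_gt; exists l.
(* Lowering the threshold to [u N], still above the infimum, excludes the index [N] itself. *)
have [|l Nl] := IHN (Num.min g (u N)).
  rewrite lt_min g_gt /= lt_neqAle eq_sym; apply/andP; split; first exact/eqP.
  by have /(_ (u N)) := ge_inf u_lb; apply; exists N.
rewrite lt_min => /andP[lg lN]; exists l => //.
by rewrite ltn_neqAle Nl andbT; apply: contraTneq lN => ->; rewrite ltxx.
Qed.

Lemma norm_sin_le {R : realType} (x : R) : `|sin x| <= `|x|.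
Proof.
wlog x_ge0 : x / 0 <= x.
  move=> wlog; have [|x_lt0] := leP 0 x; first exact: wlog.
  by rewrite -(opprK x) sinN !(normrN, opprK) -(normrN x) wlog // oppr_ge0 ltW.
have [||c _] := @MVT_segment R sin cos 0 x => //.
  by apply: continuous_subspaceT => y; exact: continuous_sin.
by rewrite sin0 !subr0 => ->; rewrite normrM ler_piMl // cos_max.
Qed.

(** Writing [g ^ n = exp (- n L)], the term of degree [q + 1] in the exponential series gives
    [n ^ q * g ^ n <= D / n]. *)
Lemma exprn_geometric_small {R : realType} (g c : R) (q : nat) :
  0 < g < 1 -> 0 < c ->
  exists N : nat, forall n, (N <= n)%N -> n%:R ^+ q * g ^+ n <= c.
Proof.
move=> /andP[g_gt0 g_lt1] c_gt0; pose L := - ln g.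
have L_gt0 : 0 < L by rewrite oppr_gt0 ln_lt0 // g_gt0.
pose D : R := q.+1`!%:R / L ^+ q.+1.
exists (Num.truncn (D / c)).+1 => n n_ge.
have n_gt0 : 0 < n%:R :> R by rewrite ltr0n (leq_trans _ n_ge).
have Dn : D / c <= n%:R.
  by rewrite ltW // (lt_le_trans (truncnS_gt _)) // ler_nat.
have -> : g ^+ n = (expR (n%:R * L))^-1.
  by rewrite /L mulrN expRN invrK expRM_natl lnK.
have fact_gt0 : 0 < q.+1`!%:R :> R by rewrite ltr0n fact_gt0.
have expL : n%:R ^+ q.+1 / D <= expR (n%:R * L).
  have := expR_ge1Dxn q (ltW (mulr_gt0 n_gt0 L_gt0)).
  apply: le_trans; rewrite /D invf_div exprMn mulrA; lra.
have D_gt0 : 0 < D by rewrite divr_gt0 // exprn_gt0.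
rewrite ler_pdivrMr ?expR_gt0 // (le_trans _ (ler_wpM2l (ltW c_gt0) expL)) //.
rewrite exprS mulrAC mulrA ler_peMl ?exprn_ge0 ?(ltW n_gt0) //.
by rewrite mulrA ler_pdivlMr // mul1r mulrC -ler_pdivrMr.
Qed.

(** * Radius terms and resonance points *)

Lemma radius_termE {R : realType} (lambda2 : R) (lambda3 : R[i]) (beta : R) :
  exists2 K : R, 0 <= K & forall alpha l,
    radius_term lambda2 lambda3 alpha beta l =
    (K * `|sin ((l%:R * alpha - beta) * pi)|) `^ (l.+1%:R^-1).
Proof.
(* If [sin (beta * pi)] is 0, its inverse is 0 by convention and [K] is 0. *)
exists (Normc.normc (real_complex R lambda2 / lambda3) *
        `|(sin (beta * pi))^-1|).
  by rewrite mulr_ge0 //; case: (_ / _) => x y; exact: sqrtr_ge0.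
move=> alpha l; rewrite /radius_term Normc.normcM -mulrA -normrM.
by rewrite [X in `|X|]mulrC /Normc.normc /= expr0n addr0 sqrtr_sqr.
Qed.

(* The points (b + j) / l with j in [-l, 3l], enumerated so that each of them
   gets an index i < (2l + 1)^2: as the indices are polynomially bounded, radii
   g^l are eventually below any power of 1 / (i + 1). *)
Definition resonance {R : realType} (b : R) (i : nat) : R :=
  let l := (Nat.sqrt i)./2 in
  (b + (i - Nat.sqrt i ^ 2)%:R - l%:R) / l%:R.

(** The bound on [k] keeps the index below [(2 * l + 1) ^ 2], so its integer square root is exactly
    [2 * l]. *)
Lemma resonanceE {R : realType} (b : R) (l k : nat) : (k <= 4 * l)%N ->
  resonance b ((2 * l) ^ 2 + k) = (b + k%:R - l%:R) / l%:R.
Proof.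
move=> k_le; rewrite /resonance.
have -> : Nat.sqrt ((2 * l) ^ 2 + k) = (2 * l)%N.
  by apply: PeanoNat.Nat.sqrt_unique; rewrite !expnS expn0; lia.
by rewrite mul2n doubleK addKn.
Qed.

Lemma frequently_small_sin_approx {R : realType} (a b K g : R) :
  0 < a < 1 -> 0 < K -> 0 < g < 1 ->
  (forall N, exists2 l, (N <= l)%N &
     K * `|sin ((l%:R * a - b) * pi)| <= g ^+ l.+1) ->
  forall p N : nat,
    exists2 i, (N <= i)%N & `|a - resonance b i| <= (i.+1%:R ^+ p)^-1.
Proof.
move=> /andP[a_gt0 a_lt1] K_gt0 g_bnd freq p N.
(* The index used below satisfies [i + 1 <= 4 (l + 1)^2], so its [p]-th power costs a factor [4 ^ p]
   and the exponent [2 * p]. *)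
have c_gt0 : 0 < K / 4 ^+ p by rewrite divr_gt0 // exprn_gt0.
have [N0 small] := exprn_geometric_small g (K / 4 ^+ p) (2 * p) g_bnd c_gt0.
(* The three summands make the index at least [N], the geometric decay effective, and
   [l >= |b| + 1], which confines [j] to the enumerated range. *)
have [l] := freq (N + N0 + (Num.truncn `|b|).+2)%N.
move=> l_ge.
have Nl : (N <= l)%N by apply: leq_trans l_ge; rewrite -addnA leq_addr.
have N0l : (N0 <= l)%N by apply: leq_trans l_ge; rewrite -addnA addnCA leq_addr.
have Tl : ((Num.truncn `|b|).+2 <= l)%N.
  by apply: leq_trans l_ge; exact: leq_addl.
have l_pos : (0 < l)%N by exact: leq_trans Tl.
have b_le : `|b| + 1 <= l%:R.
  have -> : `|b| + 1 = `|b| + 1%:R by [].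
  apply: (@le_trans _ _ (Num.truncn `|b|).+2%:R); last by rewrite ler_nat.
  by rewrite -[leRHS]natr1 lerD2r ltW // truncnS_gt.
have [j [j_half j_sin]] := dist_int_le_norm_sin (l%:R * a - b).
have l_ge1 : 1 <= l%:R :> R by rewrite ler1n.
have l_gt0 : 0 < l%:R :> R by lra.
have la_ge0 : 0 <= l%:R * a by rewrite mulr_ge0 ?ltW.
have la_le : l%:R * a <= l%:R by rewrite ler_piMr ?ltW.
have [k jk] : exists k : nat, j + l%:Z = k%:Z.
  suff : 0 <= j + l%:Z by case: (j + l%:Z) => // k _; exists k.
  rewrite -(ler_int R) intrD /=.
  move: j_half b_le; rewrite !ler_norml -[l%:~R]/(l%:R) => /andP[? ?].
  by have := ler_norm b; lra.
have jE : j%:~R = k%:R - l%:R :> R.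
  have -> : j = k%:Z - l%:Z by rewrite -jk addrK.
  by rewrite intrB.
have k_le : (k <= 4 * l)%N.
  rewrite -(ler_nat R) natrM.
  move: j_half b_le; rewrite jE ler_norml => /andP[? ?].
  by have := ler_norm (- b); rewrite normrN; lra.
move=> sin_le; exists ((2 * l) ^ 2 + k)%N.
  have l_le : (l <= (2 * l) ^ 2)%N.
    rewrite (leq_trans (leq_pmull l (ltn0Sn 1))) // expnS expn1 leq_pmull //.
    by rewrite muln_gt0.
  by rewrite (leq_trans _ (leq_addr _ _)) // (leq_trans Nl l_le).
rewrite resonanceE //.
have -> : a - (b + k%:R - l%:R) / l%:R = (l%:R * a - b - j%:~R) / l%:R.
  by rewrite jE; field; rewrite lt0r_neq0.
rewrite normrM normfV (gtr0_norm l_gt0) ler_pdivrMr //.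
set i := (_ + k)%N.
have i_le : i.+1%:R <= 4 * (l.+1%:R ^+ 2) :> R.
  rewrite -natrX -natrM ler_nat /i.
  rewrite (_ : 4 * l.+1 ^ 2 = (2 * l) ^ 2 + (8 * l + 4))%N; last by ring.
  rewrite -addnS leq_add2l addnS ltnS (leq_trans k_le) //.
  by rewrite (leq_trans _ (leq_addr _ _)) // leq_mul2r orbT.
have i_gt0 : 0 < i.+1%:R :> R by rewrite ltr0n.
have main : (g ^+ l.+1) / K <= (i.+1%:R ^+ p)^-1.
  rewrite ler_pdivrMr // mulrC ler_pdivlMr ?exprn_gt0 //.
  have -> : K = K / 4 ^+ p * 4 ^+ p by rewrite divfK // expf_neq0.
  have /small : (N0 <= l.+1)%N by exact: leqW.
  rewrite -(ler_pM2r (exprn_gt0 p (ltr0n R 4))).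
  apply: le_trans; rewrite mulrC mulrAC ler_wpM2r //.
    by rewrite exprn_ge0 // ltW //; case/andP: g_bnd.
  by rewrite exprM mulrC -exprMn lerXn2r ?nnegrE // ltW.
rewrite (le_trans j_sin) // (@le_trans _ _ (g ^+ l.+1 / K)) //.
  by rewrite ler_pdivlMr // mulrC.
by rewrite (le_trans main) // ler_peMr // invr_ge0 exprn_ge0.
Qed.

Lemma powR_invnK {R : realType} (y : R) (n : nat) : 0 <= y ->
  (y `^ (n.+1%:R^-1)) ^+ n.+1 = y.
Proof.
by move=> y_ge0; rewrite -powR_mulrn ?powR_ge0 // -powRrM mulVf // powRr1.
Qed.

(** If [K] were 0, all terms would be 0 and the infimum attained. Otherwise Kronecker approximation
    puts one term below 1, so the infimum is below 1 and terms of arbitrarily large index fall under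
    some [g < 1]. *)
Lemma inf_not_attained_small_sin {R : realType} (a b K : R) :
  let u l := (K * `|sin ((l%:R * a - b) * pi)|) `^ (l.+1%:R^-1) in
  irrational a -> 0 <= K -> (forall l, u l <> inf (range u)) ->
  0 < K /\ exists g, 0 < g < 1 /\ forall N, exists2 l, (N <= l)%N &
    K * `|sin ((l%:R * a - b) * pi)| <= g ^+ l.+1.
Proof.
move=> u a_irr K_ge0 u_inf.
have y_ge0 l : 0 <= K * `|sin ((l%:R * a - b) * pi)| by rewrite mulr_ge0.
have u_ge0 l : 0 <= u l by exact: powR_ge0.
have u_lb : has_lbound (range u) by exists 0 => _ [l _ <-].
have inf_lt_u l : inf (range u) < u l.
  rewrite lt_neqAle eq_sym; apply/andP; split; first exact/eqP.
  by have /(_ (u l)) := ge_inf u_lb; apply; exists l.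
have inf_ge0 : 0 <= inf (range u).
  by apply: lb_le_inf; [exists (u 0%N), 0%N | move=> _ [l _ <-]].
have K_gt0 : 0 < K.
  rewrite lt_neqAle K_ge0 andbT; apply/eqP => K0.
  have := le_lt_trans inf_ge0 (inf_lt_u 0%N).
  by rewrite /u -K0 mul0r powR0 ?ltxx // invr_eq0.
split=> //.
have pi_gt0 := pi_gt0 R.
(* Since [|sin (t pi)| <= |t| pi], this precision makes [K * |sin|] smaller than 1. *)
have d_gt0 : 0 < (K * pi)^-1 by rewrite invr_gt0 mulr_gt0.
have [l [m lm]] := kronecker_approx a b (K * pi)^-1 a_irr d_gt0.
have u_lt1 : u l < 1.
  rewrite -(@ltr_pXn2r _ l.+1) ?nnegrE // expr1n powR_invnK //.
  have -> : (l%:R * a - b) * pi = (l%:R * a - b - m%:~R) * pi + m%:~R * pi.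
    by rewrite -mulrDl subrK.
  rewrite norm_sinDint (le_lt_trans (ler_wpM2l K_ge0 (norm_sin_le _))) //.
  rewrite normrM (gtr0_norm pi_gt0) mulrCA.
  by rewrite -ltr_pdivlMr ?mulr_gt0 // div1r.
pose g := (inf (range u) + 1) / 2.
have inf_lt1 := lt_trans (inf_lt_u l) u_lt1.
exists g; split; first by apply/andP; split; rewrite /g; lra.
move=> N; have [|k Nk uk] := frequently_lt_inf_not_attained u u_lb u_inf N g.
  by rewrite /g; lra.
have g_ge0 : 0 <= g by exact: le_trans (ltW uk).
exists k => //; rewrite -[leLHS](powR_invnK _ k) //.
by rewrite lerXn2r ?nnegrE ?powR_ge0 //; exact: ltW.
Qed.

Theorem theorem4p9 (R : realType) (M : 'M[R]_2) (lambda2 : R) (lambda3 : R[i])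
    (beta c : R)
    (M_singular : \det M = 0)
    (eigen0 : eigenvalue M 0)
    (eigen2 : eigenvalue M lambda2)
    (lambda2_neq0 : lambda2 != 0)
    (lambda3_neq0 : lambda3 != 0)
    (beta_angle : is_angle_parameter M lambda2 beta)
    (c_bounds : 0 <= c < 1) :
  hausdorff_dim (Lset M lambda2 lambda3 beta c) = 0%E.
Proof.
have [K K_ge0 termE] := radius_termE lambda2 lambda3 beta.
(* The centres depend on [beta] alone, so a single sequence serves every [alpha] of the set. *)
apply: (hausdorff_dim_fast_limsup _ (resonance beta)).
move=> a [a_itv a_irr _ not_attained].
have uE : radius_term lambda2 lambda3 a beta =
    fun l => (K * `|sin ((l%:R * a - beta) * pi)|) `^ (l.+1%:R^-1).
  by apply/funext => l; exact: termE.
rewrite uE in not_attained.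
have [K_gt0 [g [g_itv freq]]] :=
  inf_not_attained_small_sin a beta K a_irr K_ge0 not_attained.
exact: (frequently_small_sin_approx a beta K g).
Qed.
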